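(* Let $p$ be an odd prime, let $q\in\mathbb{C}_p$ with $q\neq 1$ and $|1-q|_p<p^{-1/(p-1)}$, and let $x\in\mathbb{Z}_p$. Let $n\ge 1$ and let $w_1,\dots,w_n\in\mathbb{N}$ be positive integers with $w_1\equiv w_2\equiv\cdots\equiv w_n\equiv 1\pmod 2$. For $\sigma\in S_n$ put $W_\sigma=\prod_{j=1}^{n-1}w_{\sigma(j)}$. Then for every integer $m\ge 0$, the expression $$\frac{1}{[2]_{q^{W_\sigma}}}\sum_{l=0}^{m}\binom{m}{l}\,[W_\sigma]_q^{l}\,[w_{\sigma(n)}]_q^{m-l}\,\mathcal{E}_{l,q^{W_\sigma}}\!\left(w_{\sigma(n)}x\right)\,\hat{T}_{m,q^{w_{\sigma(n)}}}\!\left(w_{\sigma(1)},w_{\sigma(2)},\dots,w_{\sigma(n-1)}\mid l\right)$$ is the same for every $\sigma\in S_n$.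
   Context: $\mathbb{Z}_p$ is the ring of $p$-adic integers and $\mathbb{C}_p$ is the completion of an algebraic closure of $\mathbb{Q}_p$, with norm normalized by $|p|_p=1/p$. $S_n$ is the symmetric group on $\{1,\dots,n\}$. For $Q\in\mathbb{C}_p$ with $Q\ne1$ and $|1-Q|_p<p^{-1/(p-1)}$ and $z\in\mathbb{Z}_p$, write $Q^z=\exp(z\log Q)$ and $[z]_Q=\frac{1-Q^z}{1-Q}$. (If $q$ satisfies these conditions and $W$ is a positive integer, then $Q=q^W$ satisfies them too.) Carlitz-type $q$-Euler numbers $\mathcal{E}_{m,Q}$ ($m\ge0$) are defined recursively by $\mathcal{E}_{0,Q}=1$ and $$Q\sum_{l=0}^{m}\binom{m}{l}Q^{l}\mathcal{E}_{l,Q}+\mathcal{E}_{m,Q}=[2]_Q\,\delta_{0,m}\qquad(m\ge0),$$ where $\delta$ is the Kronecker delta. The Carlitz-type $q$-Euler polynomials are $$\mathcal{E}_{m,Q}(z)=\sum_{l=0}^{m}\binom{m}{l}Q^{lz}\,\mathcal{E}_{l,Q}\,[z]_Q^{m-l}\qquad(m\ge 0);$$ equivalently, $\mathcal{E}_{m,Q}(z)=\int_{\mathbb{Z}_p}[z+y]_Q^m\,d\mu_{-Q}(y)$, where $$\int_{\mathbb{Z}_p}f(y)\,d\mu_{-Q}(y)=\lim_{N\to\infty}\frac{1+Q}{1+Q^{p^N}}\sum_{y=0}^{p^N-1}f(y)(-Q)^y .$$ For positive integers $v_1,\dots,v_{n-1}$ and integers $0\le l\le m$, $$\hat{T}_{m,Q}(v_1,\dots,v_{n-1}\mid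 l)=\sum_{k_1=0}^{v_1-1}\cdots\sum_{k_{n-1}=0}^{v_{n-1}-1}(-1)^{k_1+\cdots+k_{n-1}}\,Q^{(l+1)K}\,[K]_Q^{m-l},\qquad K=\sum_{j=1}^{n-1}\Big(\prod_{\substack{1\le i\le n-1\\ i\neq j}}v_i\Big)k_j .$$ Conventions: $0^0=1$, empty products equal $1$, empty sums equal $0$; when $n=1$ the iterated sum over the $k_j$ consists of a single term (with $K=0$). *)

(* Defs.v *)
From HB Require Import structures.
From mathcomp Require Import all_boot all_order all_algebra all_fingroup.
From mathcomp Require Import all_classical all_reals all_analysis.

Set Implicit Arguments.
Unset Strict Implicit.
Unset Printing Implicit Defensive.

Import Order.TTheory GRing.Theory Num.Theory.

Local Open Scope classical_set_scope.
Local Open Scope ring_scope.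

(* The norms of MathComp ([normedZmodType]) satisfy |x *+ n| = |x| *+ n, which
   excludes non-archimedean absolute values; hence this separate structure. *)
Record ultra_absval (R : realType) (K : fieldType) := UltraAbsval {
  absval :> K -> R ;
  absval_ge0 : forall x : K, 0 <= absval x ;
  absval_eq0 : forall x : K, (absval x == 0) = (x == 0) ;
  absvalM : forall x y : K, absval (x * y) = absval x * absval y ;
  absval_ultra : forall x y : K,
    absval (x + y) <= Num.max (absval x) (absval y) }.

(* An alias of K carrying the topology of the metric (x, y) |-> v (x - y). *)
Definition valued (R : realType) (K : fieldType) (v : ultra_absval R K) : Type :=
  K.

Section ValuedMetric.
Context {R : realType} {K : fieldType} (v : ultra_absval R K).

HB.instance Definition _ := GRing.Field.copy (valued v) K.
HB.instance Definition _ := isPointed.Build (valued v) 0.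

Definition vdist (x y : valued v) : R := v (x - y).

Lemma vdistxx x : vdist x x = 0.
Proof. by apply/eqP; rewrite /vdist absval_eq0 subrr. Qed.

Lemma vdist_positivity x y : vdist x y = 0 -> x = y.
Proof. by move/eqP; rewrite /vdist absval_eq0 subr_eq0 => /eqP. Qed.

Lemma absvalN (x : K) : v (- x) = v x.
Proof.
have v11 : v 1 * v 1 = v 1 by rewrite -absvalM mulr1.
have v1n0 : v 1 != 0 by rewrite absval_eq0 oner_eq0.
have v1 : v 1 = 1 by apply: (mulfI v1n0); rewrite v11 mulr1.
have : v (- 1) ^+ 2 == 1 by rewrite expr2 -absvalM mulrNN mulr1 v1.
rewrite sqrp_eq1 ?absval_ge0// => /eqP vN1.
by rewrite -mulN1r absvalM vN1 mul1r.
Qed.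

Lemma vdist_sym x y : vdist x y = vdist y x.
Proof. by rewrite /vdist -opprB absvalN. Qed.

Lemma vdist_triangle y x z : vdist x z <= vdist x y + vdist y z.
Proof.
rewrite /vdist -[x - z](subrKA y); apply: (le_trans (absval_ultra _ _ _)).
by rewrite ge_max lerDl lerDr !absval_ge0.
Qed.

HB.instance Definition _ := isMetric.Build R (valued v)
  vdistxx vdist_positivity vdist_sym vdist_triangle.

End ValuedMetric.

Section Cp.
Context {R : realType} {K : fieldType} (v : ultra_absval R K).

(* When v is as in [is_Cp], the closures of the images of Q and Z are the
   completions Q_p and Z_p. *)
Definition padicQ : set (valued v) := closure (range (ratr : rat -> valued v)).

Definition padicZ : set (valued v) := closure (range (intr : int -> valued v)).

Definition padicQbar : set (valued v) :=
  [set x | exists f : {poly valued v},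
     [/\ f != 0, (forall i : nat, padicQ f`_i) & root f x]].

(* (K, v) is a completion of an algebraic closure of Q_p: the elements of K
   algebraic over Q_p form an algebraically closed field, and they are dense in
   the complete field K.  Since v is non-archimedean with v p = 1/p, it restricts
   to the p-adic absolute value on Q. *)
Record is_Cp (p : nat) : Prop := {
  Cp_absvalp : v p%:R = (p%:R : R)^-1 ;
  Cp_complete : forall F : set_system (valued v),
    ProperFilter F -> cauchy F -> cvg F ;
  Cp_closed : forall f : {poly valued v}, (1 < size f)%N ->
    (forall i : nat, padicQbar f`_i) ->
    exists2 x : valued v, padicQbar x & root f x ;
  Cp_dense : dense padicQbar }.

End Cp.

Section QEuler.
Context {R : realType} {F : fieldType} {v : ultra_absval R F}.
Local Notation K := (valued v).
Implicit Types (Q z t : K).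

Definition Cp_exp t : K :=
  lim (series (fun n : nat => t ^+ n / n`!%:R) @ \oo).

Definition Cp_log t : K :=
  lim (series (fun n : nat => (- 1) ^+ n * (t - 1) ^+ n.+1 / n.+1%:R) @ \oo).

Definition qpow Q z : K := Cp_exp (z * Cp_log Q).

Definition qnum Q z : K := (1 - qpow Q z) / (1 - Q).

Definition is_qEuler Q (e : nat -> K) : Prop :=
  e 0%N = 1 /\
  forall m : nat,
    Q * (\sum_(l < m.+1) 'C(m, l)%:R * Q ^+ l * e l) + e m
    = qnum Q 2%:R * (m == 0%N)%:R.

(* The recursion has exactly one solution when Q <> 1 and
   |1 - Q| < p^(-1/(p-1)), p odd: then 1 + Q^(m+1) <> 0 for all m, and
   [2]_Q = 1 + Q. *)
Definition qEuler Q : nat -> K := get (is_qEuler Q).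

Definition qEuler_poly (m : nat) Q z : K :=
  \sum_(l < m.+1) 'C(m, l)%:R * qpow Q (l%:R * z) * qEuler Q l
                  * qnum Q z ^+ (m - l).

(* The index d stands for n - 1. *)
Definition T_hat_K (d : nat) (a : 'I_d -> nat)
    (k : forall j : 'I_d, 'I_(a j)) : nat :=
  (\sum_(j < d) (\prod_(i < d | i != j) a i) * k j)%N.

Definition T_hat (d m : nat) Q (a : 'I_d -> nat) (l : nat) : K :=
  \sum_(k : {dffun forall j : 'I_d, 'I_(a j)})
    (- 1) ^+ (\sum_(j < d) k j)%N * Q ^+ (l.+1 * T_hat_K k)%N
    * qnum Q (T_hat_K k)%:R ^+ (m - l).

End QEuler.

Section Expression.
Context {R : realType} {F : fieldType} {v : ultra_absval R F}.
Local Notation K := (valued v).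
Variables (q x : K) (n : nat) (w : 'I_n.+1 -> nat) (s : 'S_n.+1).

(* There are n.+1 weights; w_{s(1)}, ..., w_{s(n)} are the ones at the positions
   other than the last one, [ord_max]. *)
Definition w_init (j : 'I_n) : nat := w (s (widen_ord (leqnSn n) j)).

Definition w_last : nat := w (s ord_max).

Definition W_prod : nat := (\prod_(j < n) w_init j)%N.

Definition sym_expr (m : nat) : K :=
  (qnum (q ^+ W_prod) 2%:R)^-1 *
  \sum_(l < m.+1)
    'C(m, l)%:R * qnum q W_prod%:R ^+ l * qnum q w_last%:R ^+ (m - l)
    * qEuler_poly l (q ^+ W_prod) (w_last%:R * x)
    * T_hat m (q ^+ w_last) w_init l.

End Expression.

(* Main.v *)
From HB Require Import structures.
From mathcomp Require Import all_boot all_order all_algebra all_fingroup.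
From mathcomp Require Import all_classical all_reals all_analysis.
From mathcomp Require Import ring lra zify.
Require Import Defs.

Set Implicit Arguments.
Unset Strict Implicit.
Unset Printing Implicit Defensive.

Import Order.TTheory GRing.Theory Num.Theory.
Import numFieldNormedType.Exports.

Local Open Scope classical_set_scope.
Local Open Scope ring_scope.

(** For Q in the disk |1 - Q| < p^(-1/(p-1)) let L_Q be the linear functional on
    polynomials with L_Q(X^j) = 1 / (1 + Q^(j+1)). It satisfies
    Q L_Q(f(QX)) + L_Q(f) = f(1), hence
    E_(m,Q) = (1 + Q) L_Q(((1 - X) / (1 - Q))^m) and
    E_(m,Q)(z) = (1 + Q) / (1 - Q)^m L_Q((1 - Q^z X)^m). Inserting this in the
    expression, the sum over l is a binomial expansion and the sum over the k_j
    is a product of geometric series. With P = w_1 ... w_n, A = q^(P x) and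
    B = q^(j+1) what remains is
    (1 - q)^(-m) sum_j C(m,j) (-A)^j (1 + B^P)^(n-1) / prod_i (1 + B^(P / w_i)),
    which is symmetric in the w_i. The p-adic input is log(Q^W) = W log Q,
    exp(a + b) = exp a exp b and exp(log Q) = Q; the last holds because
    u = exp(log Q) / Q satisfies |M| |u - 1| = |u^M - 1| <= |M|^2 for M = p^N. *)

(** * Ultrametric absolute values and geometrically dominated series *)

Section UltrametricField.
Context {R : realType} {F : fieldType} (v : ultra_absval R F).
Implicit Types x y : valued v.

Lemma absval0 : v 0 = 0.
Proof. by apply/eqP; rewrite absval_eq0. Qed.

Lemma absval1 : v 1 = 1.
Proof.
have v1n0 : v 1 != 0 by rewrite absval_eq0 oner_eq0.
by apply: (mulfI v1n0); rewrite -absvalM !mulr1.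
Qed.

Lemma absval_gt0 x : (0 < v x) = (x != 0).
Proof. by rewrite lt0r absval_eq0 absval_ge0 andbT. Qed.

Lemma absvalX x n : v (x ^+ n) = v x ^+ n.
Proof.
elim: n => [|n IHn]; first by rewrite !expr0 absval1.
by rewrite !exprS absvalM IHn.
Qed.

Lemma absvalV x : v x^-1 = (v x)^-1.
Proof.
have [->|x0] := eqVneq x 0; first by rewrite !invr0 absval0 invr0.
have vx0 : v x != 0 by rewrite absval_eq0.
by apply: (mulfI vx0); rewrite -absvalM !mulfV// absval1.
Qed.

Lemma absval_div x y : v (x / y) = v x / v y.
Proof. by rewrite absvalM absvalV. Qed.

Lemma absvalD_le x y c : v x <= c -> v y <= c -> v (x + y) <= c.
Proof.
by move=> xc yc; apply: le_trans (absval_ultra _ _ _) _; rewrite ge_max xc.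
Qed.

Lemma absvalB_le x y c : v x <= c -> v y <= c -> v (x - y) <= c.
Proof. by move=> xc yc; apply: absvalD_le; rewrite ?absvalN. Qed.

Lemma absvalD_lt x y c : v x < c -> v y < c -> v (x + y) < c.
Proof.
by move=> xc yc; apply: le_lt_trans (absval_ultra _ _ _) _; rewrite gt_max xc.
Qed.

(** Isosceles principle: were [x + y] also smaller than [y], then [y], the sum of [- x] and [x + y],
    would be smaller than itself. *)
Lemma absvalD_eqr x y : v x < v y -> v (x + y) = v y.
Proof.
move=> xy; apply/le_anti/andP; split; first exact: absvalD_le (ltW xy) _.
rewrite leNgt; apply/negP => xyy.
suff : v y < v y by rewrite ltxx.
by rewrite -{1}(addKr x y); apply: absvalD_lt; rewrite ?absvalN.
Qed.

Lemma absval_sum_le I (r : seq I) (P : pred I) (f : I -> valued v) c :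
  0 <= c -> (forall i, P i -> v (f i) <= c) -> v (\sum_(i <- r | P i) f i) <= c.
Proof.
move=> c0 fc; elim/big_ind: _ => //; first by rewrite absval0.
by move=> x y; exact: absvalD_le.
Qed.

Lemma absval_natr_le1 n : v n%:R <= 1.
Proof.
elim: n => [|n IHn]; first by rewrite absval0.
by rewrite -natr1; apply: absvalD_le; rewrite ?absval1.
Qed.

Lemma absval_intr_le1 (z : int) : v z%:~R <= 1.
Proof. by case: z => n; rewrite ?NegzE ?mulrNz ?absvalN absval_natr_le1. Qed.

Lemma ball_absvalE x e y : ball x e y = (v (x - y) < e) :> Prop.
Proof. by rewrite ballEmdist. Qed.

Lemma padicZ_absval_le1 x : padicZ x -> v x <= 1.
Proof.
move=> /(_ (ball x 1)) [|y [[z _ <-]]]; first exact: nbhsx_ballx.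
rewrite ball_absvalE => xz1.
by rewrite -[x](subrK z%:~R); apply: absvalD_le (ltW xz1) (absval_intr_le1 _).
Qed.

Lemma geometric_near0 (C theta e : R) : 0 <= theta < 1 -> 0 < e ->
  exists N, forall n, (N <= n)%N -> C * theta ^+ n < e.
Proof.
move=> /andP[th0 th1] e0.
have : (fun n => C * theta ^+ n) @ \oo --> C * 0.
  by apply: cvgMr; apply: cvg_expr; rewrite ger0_norm.
rewrite mulr0 => /cvgrPdist_lt /(_ _ e0)[N _ HN].
exists N => n /HN /=; rewrite sub0r normrN; exact: le_lt_trans (ler_norm _).
Qed.

Hypothesis v_complete :
  forall G : set_system (valued v), ProperFilter G -> cauchy G -> cvg G.

(** A block of consecutive terms is no larger than the bound on its first term, so the partial sums
    are Cauchy and the tail estimate carries no factor 1/(1 - theta). *)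
Lemma geometric_series_lim (u : (valued v)^nat) (C theta : R) :
  0 <= theta < 1 -> (forall n, v (u n) <= C * theta ^+ n) ->
  forall n, v (lim (series u @ \oo) - \sum_(k < n) u k) <= C * theta ^+ n.
Proof.
move=> th uC n; have [th0 th1] := andP th.
have C0 : 0 <= C.
  by have := uC 0%N; rewrite expr0 mulr1; apply: le_trans; exact: absval_ge0.
have tail k i : (k <= i)%N -> v (series u i - series u k) <= C * theta ^+ k.
  move=> ki; rewrite sub_series_geq//.
  rewrite big_nat; apply: absval_sum_le => [|j /andP[kj _]].
    by rewrite mulr_ge0 ?exprn_ge0.
  by apply: le_trans (uC j) _; rewrite ler_wpM2l// ler_wiXn2l// ltW.
have Scvg : cvg (series u @ \oo).
  apply: v_complete; apply/cauchy_exP => e /(geometric_near0 C th)[N HN].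
  exists (series u N); exists N => // i /= Ni.
  rewrite ball_absvalE -opprB absvalN.
  exact: le_lt_trans (tail _ _ Ni) (HN _ (leqnn _)).
apply/ler_addgt0Pr => e e0; set l := lim _.
have [N _ /(_ (maxn N n))] := (cvg_ballP _ _).1 Scvg e e0.
rewrite /= leq_maxl ball_absvalE => /(_ isT) Nle.
rewrite -(big_mkord xpredT u) -[X in v X](subrKA (series u (maxn N n))).
apply: absvalD_le.
  by apply: le_trans (ltW Nle) _; rewrite lerDr mulr_ge0 ?exprn_ge0.
apply: le_trans (tail _ _ (leq_maxr _ _)) _.
by rewrite lerDl ltW.
Qed.

(** Closed balls contain their limits, so an estimate on all late partial sums passes to the sum of
    the series. The threshold [N] excludes partial sums that are too short for the comparison. *)
Lemma geometric_series_lim_le (u : (valued v)^nat) (C theta c : R) a N :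
  0 <= theta < 1 -> (forall n, v (u n) <= C * theta ^+ n) ->
  (forall n, (N <= n)%N -> v (\sum_(k < n) u k - a) <= c) ->
  v (lim (series u @ \oo) - a) <= c.
Proof.
move=> th uC uc; apply/ler_addgt0Pr => e e0.
have c0 : 0 <= c := le_trans (absval_ge0 _ _) (uc N (leqnn N)).
have [N' /(_ (maxn N N') (leq_maxr _ _)) Ce] := geometric_near0 C th e0.
rewrite -[X in v X](subrKA (\sum_(k < maxn N N') u k)); apply: absvalD_le.
  apply: le_trans (geometric_series_lim th uC _) _.
  by apply: le_trans (ltW Ce) _; rewrite lerDr.
by apply: le_trans (uc _ (leq_maxl _ _)) _; rewrite lerDl ltW.
Qed.

Lemma absval_geometric_eq0 x (theta : R) : 0 <= theta < 1 ->
  (forall n, v x <= theta ^+ n) -> x = 0.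
Proof.
move=> th xth; apply/eqP; rewrite -(absval_eq0 v) eq_le absval_ge0 andbT.
apply/ler_addgt0Pr => e e0; rewrite add0r.
have [N /(_ N (leqnn N))] := geometric_near0 1 th e0.
by rewrite mul1r => /ltW; exact: le_trans.
Qed.

End UltrametricField.

(** * The p-adic size of integers and factorials, and the radius p^(-1/(p-1)) *)

(** Legendre's formula. Allowing any number [N] of terms lets the induction pass from [k] to
    [k %/ p] = j + 1, where (p - 1)(j + 1) + j = p(j + 1) - 1 <= k - 1. *)
Lemma logn_fact_le p n : prime p -> (p.-1 * logn p n`! <= n.-1)%N.
Proof.
move=> p_pr; rewrite logn_fact// big_add1 big_mkord /=.
suff H N k : (p.-1 * \sum_(i < N) k %/ p ^ i.+1 <= k.-1)%N by exact: H.
elim: N k => [|N IHN] k; first by rewrite big_ord0 muln0.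
rewrite big_ord_recl expn1.
under eq_bigr do rewrite lift0 expnS divnMA.
case Dk: (k %/ p)%N => [|j].
  by rewrite big1 ?muln0// => i _; rewrite div0n.
rewrite mulnDr; apply: leq_trans (leq_add (leqnn _) (IHN j.+1)) _.
have := leq_trunc_div k p; rewrite Dk; have := prime_gt1 p_pr.
by case: p {p_pr IHN Dk} => // p; case: k => //= k; nia.
Qed.

Section PadicAbsval.
Context {R : realType} {F : fieldType} (v : ultra_absval R F) (p : nat).
Hypotheses (p_pr : prime p) (v_p : v p%:R = (p%:R : R)^-1).
Implicit Types s t : valued v.

Let p_gt1 : 1 < p%:R :> R.
Proof. by rewrite ltr1n prime_gt1. Qed.

Let p_gt0 : 0 < p%:R :> R.
Proof. exact: lt_trans p_gt1. Qed.

(** Bezout gives a n = b p + 1 with |b p| < 1, so |a n| = 1, and both factors have absolute value at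
    most 1. *)
Lemma absval_natr_coprime n : coprime p n -> v n%:R = 1.
Proof.
have n_gt0 : (0 < n)%N -> coprime p n -> v n%:R = 1.
  move=> n0; rewrite coprime_sym => co_np.
  have [a b abE _] := egcdnP p n0; rewrite (eqP co_np) in abE.
  have : v (a * n)%:R = 1.
    rewrite abE natrD absvalD_eqr absval1//.
    rewrite natrM absvalM v_p; apply: le_lt_trans (_ : 1 * p%:R^-1 < 1).
      by rewrite ler_wpM2r ?absval_natr_le1 ?invr_ge0 ?(ltW p_gt0).
    by rewrite mul1r invf_lt1.
  rewrite natrM absvalM => an1; apply/le_anti; rewrite absval_natr_le1 /=.
  by rewrite -an1 ler_piMl ?absval_ge0 ?absval_natr_le1.
(* For [n = 0] coprimality would force [p = 1]. *)
by case: n n_gt0 => [|n]; [rewrite /coprime gcdn0; case: p p_pr => [|[]] | exact].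
Qed.

Lemma absval_natrE n : (0 < n)%N -> v n%:R = p%:R^-1 ^+ logn p n.
Proof.
move=> n0; have [k co_pk nE] := pfactor_coprime p_pr n0.
rewrite {1}nE natrM natrX absvalM absvalX v_p.
by rewrite absval_natr_coprime// mul1r.
Qed.

Lemma natr_valued_neq0 n : (0 < n)%N -> n%:R != 0 :> valued v.
Proof.
by move=> n0; rewrite -(absval_eq0 v) absval_natrE// expf_neq0// invr_neq0 ?gt_eqF.
Qed.

Lemma absval_pexp_eq0 t : (forall N, v t <= v (p ^ N)%:R) -> t = 0.
Proof.
move=> tp; apply: (@absval_geometric_eq0 _ _ v t p%:R^-1) => [|N].
  by rewrite invr_ge0 ltW//= invf_lt1.
by rewrite -v_p -absvalX -natrX.
Qed.

Definition exp_radius : R := p%:R `^ (- (p.-1%:R)^-1).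
Local Notation rho := exp_radius.

Lemma exp_radius_gt0 : 0 < rho.
Proof. exact: powR_gt0. Qed.

Lemma exp_radiusX : rho ^+ p.-1 = p%:R^-1.
Proof.
rewrite -powR_mulrn ?powR_ge0// -powRrM mulNr mulVf ?powR_inv1 ?ltW//.
by rewrite pnatr_eq0; case: p p_pr => [|[]].
Qed.

Lemma exp_radius_lt1 : rho < 1.
Proof.
rewrite ltNge; apply/negP => /(exprn_ege1 p.-1).
by rewrite exp_radiusX leNgt invf_lt1 ?p_gt1.
Qed.

(** Legendre's bound read through rho^(p-1) = 1/p. The shift from n to n + 1 is what leaves a
    separate factor |t| in the term estimates that follow. *)
Lemma absval_fact_ge n : rho ^+ n <= v (n.+1)`!%:R.
Proof.
rewrite absval_natrE ?fact_gt0// -exp_radiusX -exprM.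
rewrite ler_wiXn2l ?(ltW exp_radius_gt0) ?(ltW exp_radius_lt1)//.
exact: logn_fact_le.
Qed.

Lemma exp_term_le t n : v (t ^+ n.+1 / (n.+1)`!%:R) <= v t * (v t / rho) ^+ n.
Proof.
rewrite absval_div absvalX exprS -mulrA ler_wpM2l ?absval_ge0// expr_div_n.
rewrite ler_wpM2l ?exprn_ge0 ?absval_ge0//.
rewrite lef_pV2 ?posrE ?exprn_gt0 ?exp_radius_gt0 ?absval_fact_ge//.
by rewrite absval_gt0 natr_valued_neq0 ?fact_gt0.
Qed.

(** Since |n!| <= 1, dividing by n + 1 costs no more than dividing by (n + 1)!, so the exponential
    estimate applies. *)
Lemma log_term_le t n : v (t ^+ n.+1 / n.+1%:R) <= v t * (v t / rho) ^+ n.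
Proof.
apply: le_trans (exp_term_le t n).
rewrite !absval_div ler_wpM2l ?absval_ge0// factS natrM absvalM.
rewrite lef_pV2 ?posrE ?mulr_gt0 ?absval_gt0 ?natr_valued_neq0 ?fact_gt0//.
by rewrite ler_piMr ?absval_ge0 ?absval_natr_le1.
Qed.

Lemma disk_ratio t : v t < rho -> 0 <= v t / rho < 1.
Proof.
move=> t_disk; rewrite divr_ge0 ?absval_ge0 ?powR_ge0//=.
by rewrite ltr_pdivrMr ?mul1r ?exp_radius_gt0.
Qed.

End PadicAbsval.

(** * The p-adic exponential and logarithm on the disk of radius rho *)

Section ExpLog.
Context {R : realType} {F : fieldType} (v : ultra_absval R F) (p : nat).
Hypotheses (p_pr : prime p) (v_p : v p%:R = (p%:R : R)^-1).
Hypothesis v_complete :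
  forall G : set_system (valued v), ProperFilter G -> cauchy G -> cvg G.
Implicit Types s t z Q : valued v.
Local Notation rho := (@exp_radius R p).
Local Notation natr_neq0 := (natr_valued_neq0 p_pr v_p).

(** Binomial expansion with C(M, k+1) = M C(M-1, k) / (k+1). After division by M this is the
    logarithm series with C(M-1, k) in place of (-1)^k; a free length [n] allows a termwise
    comparison. *)
Lemma exprn_sub1E Q M n : (M <= n)%N ->
  Q ^+ M - 1
  = M%:R * \sum_(k < n) 'C(M.-1, k)%:R * ((Q - 1) ^+ k.+1 / k.+1%:R).
Proof.
case: M => [|M] Mn; first by rewrite expr0 subrr mul0r.
rewrite -{1}[Q](subrK 1); set s := Q - 1.
rewrite exprD1n big_ord_recl bin0 expr0 mulr1n [1 + _]addrC addrK mulr_sumr.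
rewrite (big_ord_widen n (fun k => s ^+ k.+1 *+ 'C(M.+1, k.+1)) Mn) big_mkcond.
apply: eq_bigr => k _; case: ltnP => [_|Mk]; last first.
  by rewrite bin_small// mul0r mulr0.
have k0 : k.+1%:R != 0 :> valued v by exact: natr_neq0.
rewrite -mulr_natl [RHS]mulrA -natrM (mul_bin_diag M.+1) natrM.
by rewrite [_%:R * _%:R]mulrC mulrACA mulfV// mulr1.
Qed.

Lemma absval_exprn_sub1 Q M : v (Q - 1) < rho ->
  v (Q ^+ M - 1) = v M%:R * v (Q - 1).
Proof.
move=> s_disk; have [|s0] := eqVneq (Q - 1) 0.
  by move=> Q1; rewrite (subr0_eq Q1) expr1n subrr !absval0 mulr0.
case: M => [|M]; first by rewrite expr0 subrr !absval0 mul0r.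
move: s0 s_disk; rewrite (@exprn_sub1E _ _ M.+1)//; set s := Q - 1 => s0 s_disk.
rewrite absvalM; congr (_ * _).
(* The term k = 0 is [s] itself; all others are smaller by the factor [v s / rho] < 1, so it
   dominates. *)
rewrite big_ord_recl bin0 mul1r expr1 divr1 addrC.
have [th0 th1] := andP (disk_ratio p_pr s_disk).
apply: absvalD_eqr; apply: (@le_lt_trans _ _ (v s * (v s / rho))); last first.
  by rewrite gtr_pMr ?absval_gt0.
apply: absval_sum_le => [|k _]; first by rewrite mulr_ge0 ?absval_ge0.
rewrite absvalM -[leRHS]mul1r ler_pM ?absval_ge0 ?absval_natr_le1//.
apply: le_trans (log_term_le p_pr v_p _ _) _.
rewrite lift0 ler_wpM2l ?absval_ge0// exprS ler_piMr// exprn_ile1//.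
exact: ltW.
Qed.

(** Modulo M the product (M-1)(M-2)...(M-k) is (-1)^k k!, which makes C(M-1, k) p-adically close to
    (-1)^k when M is a high power of p. *)
Lemma ffact_pred_modn M k : (0 < M)%N ->
  exists z : int, ((M.-1) ^_ k)%:R
    = (-1) ^+ k * (k`!)%:R + M%:R * z%:~R :> valued v.
Proof.
move=> M0; elim: k => [|k [z zE]].
  by exists 0; rewrite ffactn0 fact0 expr0 mulr1 mulr0 addr0.
rewrite ffactnSr natrM zE.
have [kM|Mk] := leqP k M.-1.
  exists ((-1) ^+ k * (k`!)%:Z + z * (M%:Z - k.+1%:Z)).
  have -> : (M.-1 - k)%:R = M%:R - k.+1%:R :> valued v.
    by rewrite -natrB; [congr (_%:R); lia | lia].
  rewrite factS natrM !(rmorphD, rmorphM, rmorphN, rmorphXn, rmorphB) /= exprS.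
  rewrite -!pmulrn; ring.
(* Here the subtraction [M.-1 - k] is truncated, but the falling factorial of length k is already 0,
   so the previous congruence is multiplied by -(k + 1). *)
exists (- (k.+1%:Z * z)); move: zE; rewrite ffact_small// mulr0n => zE.
rewrite -zE mul0r factS natrM rmorphN rmorphM /= exprS -pmulrn.
transitivity (- k.+1%:R * 0 : valued v); first by rewrite mulr0.
by rewrite zE; ring.
Qed.

Lemma exp_term_geometric t n : v t < rho ->
  v (t ^+ n / n`!%:R) <= 1 * (v t / rho) ^+ n.
Proof.
move=> t_disk; rewrite mul1r; case: n => [|n].
  by rewrite !expr0 fact0 divr1 absval1.
apply: le_trans (exp_term_le p_pr v_p _ _) _.
rewrite exprS ler_wpM2r ?exprn_ge0//; first by case/andP: (disk_ratio p_pr t_disk).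
rewrite ler_pdivlMr ?exp_radius_gt0// ler_piMr ?absval_ge0//.
exact/ltW/exp_radius_lt1.
Qed.

Lemma log_term_geometric t n :
  v ((-1) ^+ n * t ^+ n.+1 / n.+1%:R) <= v t * (v t / rho) ^+ n.
Proof.
rewrite -mulrA absvalM absvalX absvalN absval1 expr1n mul1r.
exact: log_term_le.
Qed.

Lemma Cp_log_le Q : v (Q - 1) < rho -> v (Cp_log Q) <= v (Q - 1).
Proof.
move=> t_disk; rewrite /Cp_log -[X in v X]subr0; set t := Q - 1 in t_disk *.
have th := disk_ratio p_pr t_disk; have [th0 th1] := andP th.
apply: (@geometric_series_lim_le _ _ _ v_complete _ (v t) _ _ _ 0%N th) => n.
  exact: log_term_geometric.
move=> _; rewrite subr0; apply: absval_sum_le => [|k _]; first exact: absval_ge0.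
apply: le_trans (log_term_geometric _ _) _.
by rewrite ler_piMr ?absval_ge0// exprn_ile1// ltW.
Qed.

(* The difference quotients at M = p ^ N tend to the logarithm. *)
Lemma Cp_log_approx Q M : v (Q - 1) < rho -> (0 < M)%N ->
  v (Cp_log Q - (Q ^+ M - 1) / M%:R) <= v M%:R.
Proof.
move=> t_disk M0; rewrite /Cp_log.
have th := disk_ratio p_pr t_disk; have [th0 th1] := andP th.
apply: (@geometric_series_lim_le _ _ _ v_complete _ (v (Q - 1)) _ _ _ M th) => n.
  exact: log_term_geometric.
move=> Mn; rewrite (exprn_sub1E _ Mn) mulrC mulKf ?natr_neq0// -sumrB.
move: t_disk th th0 th1; set t := Q - 1 => t_disk th th0 th1.
apply: absval_sum_le => [|k _]; first exact: absval_ge0.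
have [z zE] := ffact_pred_modn k M0.
(* The congruence turns the difference of the k-th terms into M times an integer times an
   exponential term of absolute value at most 1. *)
have -> : (-1) ^+ k * t ^+ k.+1 / k.+1%:R - 'C(M.-1, k)%:R * (t ^+ k.+1 / k.+1%:R)
    = - (M%:R * (z%:~R * (t ^+ k.+1 / (k.+1)`!%:R))).
  have -> : 'C(M.-1, k)%:R = ((-1) ^+ k * (k`!)%:R + M%:R * z%:~R) / (k`!)%:R
      :> valued v.
    by rewrite -zE -bin_ffact natrM mulfK ?natr_neq0 ?fact_gt0.
  have k0 : k.+1%:R != 0 :> valued v by exact: natr_neq0.
  have k1 : k`!%:R != 0 :> valued v by rewrite natr_neq0 ?fact_gt0.
  rewrite factS natrM; move: k0 k1; move: (k.+1%:R : valued v) => a a0 b0.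
  by field; rewrite b0 a0.
rewrite absvalN absvalM ler_piMr ?absval_ge0// absvalM.
rewrite mulr_ile1 ?absval_ge0 ?absval_intr_le1//.
apply: le_trans (exp_term_le p_pr v_p _ _) _.
rewrite mulr_ile1 ?absval_ge0 ?exprn_ge0// ?exprn_ile1 ?(ltW th1)//.
by apply/ltW/(lt_trans t_disk)/exp_radius_lt1.
Qed.

(** The difference quotient of Q^W at M is W times that of Q at W M; both approximate their
    logarithms up to |M|, with M = p^N arbitrary. *)
Lemma Cp_logX Q W : v (Q - 1) < rho -> (0 < W)%N ->
  Cp_log (Q ^+ W) = W%:R * Cp_log Q.
Proof.
move=> Q_disk W0; apply: subr0_eq; apply: (absval_pexp_eq0 p_pr v_p) => N.
set M := (p ^ N)%N; have M0 : (0 < M)%N by rewrite expn_gt0 prime_gt0.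
have QW_disk : v (Q ^+ W - 1) < rho.
  rewrite absval_exprn_sub1//; apply: le_lt_trans Q_disk.
  by rewrite ler_piMl ?absval_ge0 ?absval_natr_le1.
rewrite -(subrKA (((Q ^+ W) ^+ M - 1) / M%:R)); apply: absvalD_le.
  exact: Cp_log_approx.
have -> : ((Q ^+ W) ^+ M - 1) / M%:R - W%:R * Cp_log Q
    = - (W%:R * (Cp_log Q - (Q ^+ (W * M) - 1) / (W * M)%:R)).
  have ? := natr_neq0 W0; have ? := natr_neq0 M0.
  by rewrite -exprM natrM; field; apply/andP.
rewrite absvalN absvalM; apply: le_trans (_ : 1 * v (W * M)%:R <= _).
  rewrite ler_pM ?absval_ge0 ?absval_natr_le1//.
  by apply: Cp_log_approx => //; rewrite muln_gt0 W0.
by rewrite mul1r natrM absvalM ler_piMl ?absval_ge0 ?absval_natr_le1.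
Qed.

Lemma Cp_exp_le1 t : v t < rho -> v (Cp_exp t) <= 1.
Proof.
move=> t_disk; have th := disk_ratio p_pr t_disk; have [th0 th1] := andP th.
rewrite -[X in v X]subr0.
apply: (@geometric_series_lim_le _ _ _ v_complete _ 1 _ _ _ 0%N th) => n.
  exact: exp_term_geometric.
move=> _; rewrite subr0; apply: absval_sum_le => // k _.
by apply: le_trans (exp_term_geometric _ t_disk) _; rewrite mul1r exprn_ile1// ltW.
Qed.

Lemma Cp_exp_sub1 t : v t < rho -> v (Cp_exp t - 1) <= v t.
Proof.
move=> t_disk; have th := disk_ratio p_pr t_disk; have [th0 th1] := andP th.
apply: (@geometric_series_lim_le _ _ _ v_complete _ 1 _ _ _ 1%N th).
  by move=> n; exact: exp_term_geometric.
case=> // n _; rewrite big_ord_recl expr0 divr1 [1 + _]addrC addrK.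
apply: absval_sum_le => [|k _]; first exact: absval_ge0.
apply: le_trans (exp_term_le p_pr v_p _ _) _.
by rewrite ler_piMr ?absval_ge0// exprn_ile1// ltW.
Qed.

(** Every term of degree at least 2 contains M^2, and the remaining t^k / k! is at most 1 in
    absolute value. Partial sums are taken of length at least 2 so that the two subtracted terms
    cancel. *)
Lemma Cp_exp_approx t M : v t < rho ->
  v (Cp_exp (M%:R * t) - 1 - M%:R * t) <= v M%:R ^+ 2.
Proof.
move=> t_disk; have [th0 th1] := andP (disk_ratio p_pr t_disk).
have Mt_disk : v (M%:R * t) < rho.
  apply: le_lt_trans t_disk.
  by rewrite absvalM ler_piMl ?absval_ge0 ?absval_natr_le1.
have th := disk_ratio p_pr Mt_disk; rewrite -addrA -opprD.
apply: (@geometric_series_lim_le _ _ _ v_complete _ 1 _ _ _ 2%N th).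
  by move=> n; exact: exp_term_geometric.
case=> [|[|n]] // _; rewrite !big_ord_recl expr0 divr1 expr1 divr1.
rewrite addrA [X in X - _]addrC addrK.
apply: absval_sum_le => [|k _]; first by rewrite exprn_ge0 ?absval_ge0.
rewrite !lift0 exprMn -mulrA absvalM absvalX -[leRHS]mulr1.
rewrite ler_pM ?absval_ge0 ?exprn_ge0 ?ler_wiXn2l ?absval_ge0 ?absval_natr_le1//.
apply: le_trans (exp_term_geometric _ t_disk) _.
by rewrite mul1r exprn_ile1// ltW.
Qed.

(** Cauchy product on partial sums. The larger of |s| and |t| bounds |s + t| as well, so one ratio
    [theta] controls all three series. *)
Lemma Cp_expD s t : v s < rho -> v t < rho ->
  Cp_exp (s + t) = Cp_exp s * Cp_exp t.
Proof.
move=> s_disk t_disk; pose theta := Num.max (v s) (v t) / rho.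
have th : 0 <= theta < 1.
  rewrite /theta divr_ge0 ?powR_ge0 ?le_max ?absval_ge0//=.
  by rewrite ltr_pdivrMr ?exp_radius_gt0// mul1r gt_max s_disk.
have [th0 th1] := andP th.
have th_le (r : valued v) : v r <= Num.max (v s) (v t) ->
    forall n, v (r ^+ n / n`!%:R) <= 1 * theta ^+ n.
  move=> r_le n; apply: le_trans (exp_term_geometric n _) _.
    by apply: le_lt_trans r_le _; rewrite gt_max s_disk.
  rewrite !mul1r lerXn2r ?nnegrE ?th0 ?divr_ge0 ?absval_ge0 ?powR_ge0//.
  by rewrite /theta ler_pM2r ?invr_gt0 ?exp_radius_gt0.
have s_le : v s <= Num.max (v s) (v t) by rewrite le_max lexx.
have t_le : v t <= Num.max (v s) (v t) by rewrite le_max lexx orbT.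
have st_le := absval_ultra v s t.
pose P (r : valued v) n : valued v := \sum_(k < n) r ^+ k / k`!%:R.
have trunc (r : valued v) : v r <= Num.max (v s) (v t) ->
    forall n, v (Cp_exp r - P r n) <= theta ^+ n.
  move=> r_le n; rewrite -[leRHS]mul1r.
  exact: geometric_series_lim (th_le r r_le) n.
apply: esym; apply: subr0_eq; apply: (absval_geometric_eq0 th) => n.
have Ps_le1 : v (P s n) <= 1.
  apply: absval_sum_le => // k _; apply: le_trans (th_le _ s_le _) _.
  by rewrite mul1r exprn_ile1// ltW.
(* Three truncation errors, then the finite product of partial sums against the partial sum at s +
   t. *)
have -> : Cp_exp s * Cp_exp t - Cp_exp (s + t)
    = (Cp_exp s - P s n) * Cp_exp t + P s n * (Cp_exp t - P t n)
      - (Cp_exp (s + t) - P (s + t) n) + (P s n * P t n - P (s + t) n) by ring.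
apply: absvalD_le; first apply: absvalB_le; first apply: absvalD_le.
- rewrite absvalM -[leRHS]mulr1 ler_pM ?absval_ge0 ?trunc//.
  exact: Cp_exp_le1.
- by rewrite absvalM -[leRHS]mul1r ler_pM ?absval_ge0 ?trunc.
- exact: trunc.
pose f i j : valued v := s ^+ i / i`!%:R * (t ^+ j / j`!%:R).
(* By the binomial theorem the partial sum at s + t runs over the triangle i + j < n, the product
   over the square i, j < n. *)
have -> : P (s + t) n = \sum_(0 <= i < n) \sum_(0 <= j < n - i) f i j.
  transitivity (\sum_(0 <= k < n) \sum_(0 <= i < n | (i <= k)%N) f i (k - i)%N).
    rewrite /P -(big_mkord xpredT (fun k => (s + t) ^+ k / k`!%:R)).
    apply: eq_big_nat => k /andP[_ kn].
    rewrite addrC exprDn mulr_suml.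
    rewrite -(big_mkord xpredT (fun i => t ^+ (k - i) * s ^+ i *+ 'C(k, i) / k`!%:R)).
    rewrite (big_nat_widen _ _ _ _ _ kn) [RHS]big_mkcond [LHS]big_mkcond /=.
    apply: eq_bigr => i _; rewrite ltnS; case: leqP => // ik.
    rewrite /f -(bin_fact ik) -mulr_natl !natrM.
    have ? : 'C(k, i)%:R != 0 :> valued v by rewrite natr_neq0 ?bin_gt0.
    have ? : i`!%:R != 0 :> valued v by rewrite natr_neq0 ?fact_gt0.
    have ? : (k - i)`!%:R != 0 :> valued v by rewrite natr_neq0 ?fact_gt0.
    by field; apply/and3P.
  rewrite (exchange_big_dep_nat xpredT)//=; apply: eq_big_nat => i /andP[_ i_n].
  rewrite -(big_nat_widenl i 0 n xpredT (fun k => f i (k - i)%N))//.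
  rewrite -{1}[i]add0n big_addn.
  by under eq_bigr do rewrite addnK.
rewrite /P -!(big_mkord xpredT (fun k => _ ^+ k / k`!%:R)) big_distrlr /=.
rewrite -sumrB; apply: absval_sum_le => [|i _]; first exact: exprn_ge0.
(* Only the pairs with i + j >= n survive, and each is bounded by theta^(i+j). *)
rewrite (big_cat_nat (leq0n (n - i)) (leq_subr _ _)) /= [X in X - _]addrC addrK.
rewrite big_nat; apply: absval_sum_le => [|j /andP[nj _]]; first exact: exprn_ge0.
rewrite absvalM; apply: le_trans (_ : theta ^+ i * theta ^+ j <= _).
  by rewrite ler_pM ?absval_ge0//; rewrite -[leRHS]mul1r th_le.
by rewrite -exprD ler_wiXn2l ?(ltW th1)//; lia.
Qed.

Lemma Cp_exp_natM t n : v t < rho -> Cp_exp (n%:R * t) = Cp_exp t ^+ n.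
Proof.
move=> t_disk; elim: n => [|n IHn].
  apply: subr0_eq; apply/eqP; rewrite -(absval_eq0 v) eq_le absval_ge0 andbT.
  rewrite mul0r expr0 -[leRHS](absval0 v).
  by apply: Cp_exp_sub1; rewrite absval0 exp_radius_gt0.
rewrite -natr1 mulrDl mul1r exprSr Cp_expD ?IHn//.
rewrite absvalM; apply: le_lt_trans t_disk.
by rewrite ler_piMl ?absval_ge0 ?absval_natr_le1.
Qed.

Lemma Cp_logK Q : v (Q - 1) < rho -> Cp_exp (Cp_log Q) = Q.
Proof.
move=> Q_disk; have L_disk := le_lt_trans (Cp_log_le Q_disk) Q_disk.
set L := Cp_log Q in L_disk *; apply: subr0_eq.
apply: (absval_pexp_eq0 p_pr v_p) => N.
set M := (p ^ N)%N; have M0 : (0 < M)%N by rewrite expn_gt0 prime_gt0.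
have vM0 : 0 < v M%:R by rewrite absval_gt0 natr_neq0.
have vQ : v Q = 1.
  rewrite -[Q](subrK 1) absvalD_eqr absval1//.
  by apply: (lt_trans Q_disk); exact: exp_radius_lt1.
have Q0 : Q != 0 by rewrite -(absval_eq0 v) vQ oner_eq0.
have uE n : v ((Cp_exp L / Q) ^+ n - 1) = v (Cp_exp L ^+ n - Q ^+ n).
  rewrite -[1](divff (expf_neq0 n Q0)) expr_div_n -mulrBl absval_div absvalX vQ.
  by rewrite expr1n divr1.
have := uE 1%N; rewrite !expr1 => u1E.
(* The quotient u = exp(L) / Q lies in the disk because exp(L) and Q are both within rho of 1. *)
have := uE M; rewrite absval_exprn_sub1 ?u1E => [uME|]; last first.
  rewrite -[Cp_exp L](subrK 1) -addrA -[1 - Q]opprB; apply: absvalD_lt.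
    exact: le_lt_trans (Cp_exp_sub1 L_disk) L_disk.
  by rewrite absvalN.
rewrite -(ler_pM2l vM0) uME -expr2 -Cp_exp_natM//.
(* Both exp(M L) and Q^M agree with 1 + M L up to |M|^2. *)
have -> : Cp_exp (M%:R * L) - Q ^+ M
    = Cp_exp (M%:R * L) - 1 - M%:R * L + M%:R * (L - (Q ^+ M - 1) / M%:R).
  by have ? := natr_neq0 M0; field.
apply: absvalD_le; first exact: Cp_exp_approx.
by rewrite absvalM expr2 ler_wpM2l ?absval_ge0//; exact: Cp_log_approx.
Qed.

Lemma qpow_natr Q n : v (Q - 1) < rho -> qpow Q n%:R = Q ^+ n.
Proof.
move=> Q_disk; rewrite /qpow Cp_exp_natM ?Cp_logK//.
exact: le_lt_trans (Cp_log_le Q_disk) Q_disk.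
Qed.

Lemma qpow_natM Q z l : v (Q - 1) < rho -> v z <= 1 ->
  qpow Q (l%:R * z) = qpow Q z ^+ l.
Proof.
move=> Q_disk z1; rewrite /qpow -mulrA Cp_exp_natM// absvalM.
apply: (le_lt_trans _ Q_disk).
by apply: le_trans (Cp_log_le Q_disk); rewrite ler_piMl ?absval_ge0.
Qed.

Lemma qpowX Q z W : v (Q - 1) < rho -> (0 < W)%N ->
  qpow (Q ^+ W) z = qpow Q (W%:R * z).
Proof.
by move=> Q_disk W0; rewrite /qpow Cp_logX// mulrA [z * _]mulrC.
Qed.

End ExpLog.

(** * Finite sums: dependent distributivity and alternating geometric sums *)

(** Needed because the range of each k_j depends on j. The inner sums are moved to the tagged union
    of the [T i], and the choice functions return through the bijection [fprod_of_dffun]. *)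
Lemma bigA_distr_dffun (S : comPzSemiRingType) (I : finType) (T : I -> finType)
    (G : forall i, T i -> S) :
  \prod_i \sum_(j : T i) G i j
  = \sum_(f : {dffun forall i, T i}) \prod_i G i (f i).
Proof.
under eq_bigr => i _ do rewrite (big_tag (fun i j => G i j) i).
rewrite bigA_distr_big_dep.
transitivity (\sum_(f : fprod T) \prod_i [ffun j => G i j] (f i)).
  rewrite (@big_fprod _ _ _ _ _ _ _ (fun i => [ffun j => G i j])).
  apply: eq_bigr => f _; apply: eq_bigr => i _.
  by rewrite /untag; case: eqP => // ?; rewrite ffunE.
rewrite (reindex (@fprod_of_dffun _ T)).
  by apply: eq_bigr => f _; apply: eq_bigr => i _; rewrite ffunE fprodE.
exact/onW_bij/fprod_of_dffun_bij.
Qed.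

(** Oddness of [n] turns the numerator 1 - (-y)^n into 1 + y^n. *)
Lemma alternating_geometric_sum (K : fieldType) (y : K) n : odd n -> 1 + y != 0 ->
  \sum_(k < n) (- y) ^+ k = (1 + y ^+ n) / (1 + y).
Proof.
move=> n_odd y1; apply: (mulIf y1); rewrite divfK//.
have := subrX1 (- y) n; rewrite exprNn -signr_odd n_odd expr1 mulN1r => E.
have -> : 1 + y ^+ n = - (- y ^+ n - 1) by ring.
by rewrite E; ring.
Qed.

(** * The linear functional behind the q-Euler numbers *)

Section EulerMoment.
Variables (K : fieldType) (Q : K).
Implicit Types f g : {poly K}.

(** For p odd and Q in the disk, 1 + Q times this value is the p-adic integral of f(Q^y) against the
    measure mu_(-Q), here in purely algebraic form. *)
Definition euler_moment f : K := \sum_(i < size f) f`_i / (1 + Q ^+ i.+1).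

Lemma euler_moment_widen n f : (size f <= n)%N ->
  euler_moment f = \sum_(i < n) f`_i / (1 + Q ^+ i.+1).
Proof.
move=> fn; rewrite /euler_moment.
rewrite (big_ord_widen n (fun i => f`_i / (1 + Q ^+ i.+1)) fn) big_mkcond.
apply: eq_bigr => i _; case: ltnP => // fi.
by rewrite nth_default// mul0r.
Qed.

Lemma euler_moment_is_linear : linear_for *%R euler_moment.
Proof.
move=> a f g; pose n := maxn (size (a *: f + g)) (maxn (size f) (size g)).
rewrite !(@euler_moment_widen n) ?leq_max ?leqnn ?orbT// mulr_sumr -big_split.
by apply: eq_bigr => i _; rewrite coefD coefZ mulrDl mulrA.
Qed.

HB.instance Definition _ :=
  GRing.isLinear.Build K {poly K} K *%R euler_moment euler_moment_is_linear.

Lemma euler_momentXn i : euler_moment 'X^i = (1 + Q ^+ i.+1)^-1.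
Proof.
rewrite (@euler_moment_widen i.+1) ?size_polyXn// (bigD1 ord_max)//= big1.
  by rewrite coefXn eqxx mul1r addr0.
by move=> j; rewrite -val_eqE coefXn /= => /negPf->; rewrite mul0r.
Qed.

Lemma euler_moment_binomial a m :
  euler_moment ((1 - a *: 'X) ^+ m)
  = \sum_(j < m.+1) 'C(m, j)%:R * (- a) ^+ j / (1 + Q ^+ j.+1).
Proof.
rewrite addrC exprD1n raddf_sum; apply: eq_bigr => j _ /=.
by rewrite raddfMn /= -scaleNr exprZn linearZ /= euler_momentXn -[LHS]mulr_natl mulrA.
Qed.

(** Binomial theorem for 1 - c a X = (1 - c) + c (1 - a X). It serves with c = Q for the recursion,
    c = Q^z for the polynomials, and c = q^(uK) for the sum over l. *)
Lemma euler_moment_mix c a m :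
  euler_moment ((1 - (c * a) *: 'X) ^+ m)
  = \sum_(l < m.+1) 'C(m, l)%:R * c ^+ l * (1 - c) ^+ (m - l)
                    * euler_moment ((1 - a *: 'X) ^+ l).
Proof.
have -> : 1 - (c * a) *: 'X = (1 - c)%:P + c *: (1 - a *: 'X) :> {poly K}.
  by rewrite scalerBr alg_polyC polyCB polyC1 addrA subrK scalerA.
rewrite exprDn raddf_sum; apply: eq_bigr => l _ /=.
rewrite -polyC_exp mul_polyC exprZn scalerA raddfMn /= linearZ /=.
by rewrite -[LHS]mulr_natl mulrA; congr (_ * _); ring.
Qed.

Hypothesis Q_neqN1 : forall i, 1 + Q ^+ i.+1 != 0.

(** On X^i the left side is (Q^(i+1) + 1) / (1 + Q^(i+1)) = 1. *)
Lemma euler_moment_dilation f :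
  Q * euler_moment (f \Po (Q *: 'X)) + euler_moment f = f.[1].
Proof.
rewrite comp_polyE raddf_sum mulr_sumr -big_split /= -[in RHS](comp_polyXr f).
rewrite [in RHS]comp_polyE horner_sum; apply: eq_bigr => i _.
rewrite exprZn !linearZ /= euler_momentXn hornerZ hornerXn expr1n mulr1.
have := Q_neqN1 i; rewrite exprS => Qi; field.
exact: Qi.
Qed.

End EulerMoment.

(** * The q-Euler numbers and polynomials as values of the functional *)

Section QEulerPoly.
Context {R : realType} {F : fieldType} (v : ultra_absval R F).
Implicit Types Q z : valued v.

(** In the m-th relation the coefficient of the m-th number is 1 + Q^(m+1), which is nonzero. *)
Lemma is_qEuler_uniq Q e e' : (forall i, 1 + Q ^+ i.+1 != 0) ->
  is_qEuler Q e -> is_qEuler Q e' -> e =1 e'.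
Proof.
move=> Q_neqN1 [e0 eS] [e'0 e'S]; elim/ltn_ind => m IHm.
have := eS m; rewrite -(e'S m) !big_ord_recr /= binn mul1r.
under eq_bigr => l _ do rewrite IHm//.
move=> /eqP; rewrite -subr_eq0 => /eqP E.
apply/eqP; rewrite -subr_eq0; apply/eqP; apply: (mulfI (Q_neqN1 m)).
rewrite mulr0 -[RHS]E exprS; ring.
Qed.

(** The dilation identity for (1 - X)^m, whose value at 1 vanishes unless m = 0; the dilated power
    (1 - Q X)^m expands into the sum of the recursion. *)
Lemma is_qEuler_moment Q : Q != 1 -> (forall i, 1 + Q ^+ i.+1 != 0) ->
  qnum Q 2%:R = 1 + Q ->
  is_qEuler Q (fun m => (1 + Q) / (1 - Q) ^+ m * euler_moment Q ((1 - 'X) ^+ m)).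
Proof.
move=> Q1 Q_neqN1 Q2; have Q1' : 1 - Q != 0 by rewrite subr_eq0 eq_sym.
have Q0 := Q_neqN1 0%N; rewrite expr1 in Q0.
split=> [|m].
  have := euler_momentXn Q 0; rewrite !expr0 expr1 => ->.
  by rewrite divr1 mulfV.
transitivity ((1 + Q) / (1 - Q) ^+ m * ((1 - 'X) ^+ m : {poly valued v}).[1]).
  rewrite -(euler_moment_dilation Q_neqN1) mulrDr; congr (_ + _).
  rewrite [RHS]mulrCA; congr (_ * _).
  rewrite rmorphXn rmorphB /= comp_polyX.
  rewrite rmorph1 -[X in X *: 'X]mulr1 euler_moment_mix mulr_sumr.
  apply: eq_bigr => l _; rewrite scale1r.
  have -> : (1 - Q) ^+ m = (1 - Q) ^+ (m - l) * (1 - Q) ^+ l.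
    by rewrite -exprD subnK ?leq_ord.
  have ? := expf_neq0 l Q1'; have ? := expf_neq0 (m - l) Q1'.
  by field; apply/andP.
rewrite horner_exp !hornerE subrr expr0n Q2; case: eqP => [->|_].
  by rewrite expr0 divr1.
by rewrite !mulr0.
Qed.

Variable p : nat.
Hypotheses (p_pr : prime p) (v_p : v p%:R = (p%:R : R)^-1).
Hypothesis p_odd : odd p.
Hypothesis v_complete :
  forall G : set_system (valued v), ProperFilter G -> cauchy G -> cvg G.
Local Notation rho := (@exp_radius R p).

Lemma exprn_disk Q n : v (Q - 1) < rho -> v (Q ^+ n - 1) < rho.
Proof.
move=> Q_disk; rewrite (absval_exprn_sub1 p_pr v_p)//.
by apply: le_lt_trans Q_disk; rewrite ler_piMl ?absval_ge0 ?absval_natr_le1.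
Qed.

Lemma exprn_neq1 Q n : v (Q - 1) < rho -> Q != 1 -> (0 < n)%N -> Q ^+ n != 1.
Proof.
move=> Q_disk Q1 n0; rewrite -subr_eq0 -(absval_eq0 v).
rewrite (absval_exprn_sub1 p_pr v_p)// mulf_neq0 ?absval_eq0 ?subr_eq0//.
exact: (natr_valued_neq0 p_pr v_p).
Qed.

(** As p is odd, |2| = 1, while 1 + Q^n differs from 2 by less than 1. *)
Lemma add1_exprn_neq0 Q n : v (Q - 1) < rho -> 1 + Q ^+ n != 0.
Proof.
move=> Q_disk; rewrite -(absval_eq0 v).
have v2 : v 2%:R = 1.
  by apply: (absval_natr_coprime p_pr v_p); rewrite coprimen2.
have -> : 1 + Q ^+ n = Q ^+ n - 1 + 2%:R by ring.
rewrite absvalD_eqr ?v2 ?oner_eq0//.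
by apply: lt_trans (exprn_disk n Q_disk) _; exact: exp_radius_lt1.
Qed.

Lemma qnum_natr Q n : v (Q - 1) < rho -> qnum Q n%:R = (1 - Q ^+ n) / (1 - Q).
Proof. by move=> Q_disk; rewrite /qnum (qpow_natr p_pr v_p). Qed.

Lemma qnum2 Q : v (Q - 1) < rho -> Q != 1 -> qnum Q 2%:R = 1 + Q.
Proof.
move=> Q_disk; rewrite qnum_natr// eq_sym -subr_eq0 => Q1.
by field.
Qed.

Lemma qEulerE Q m : v (Q - 1) < rho -> Q != 1 ->
  qEuler Q m = (1 + Q) / (1 - Q) ^+ m * euler_moment Q ((1 - 'X) ^+ m).
Proof.
move=> Q_disk Q1.
have Q_neqN1 i : 1 + Q ^+ i.+1 != 0 by exact: add1_exprn_neq0.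
have QE := is_qEuler_moment Q1 Q_neqN1 (qnum2 Q_disk Q1).
apply: (is_qEuler_uniq Q_neqN1 _ QE).
(* [get] returns a genuine solution, not its default value, since the moments provide one. *)
by apply: (@getPex _ (is_qEuler Q)); eexists; exact: QE.
Qed.

Lemma qEuler_polyE Q z m : v (Q - 1) < rho -> Q != 1 -> v z <= 1 ->
  qEuler_poly m Q z
  = (1 + Q) / (1 - Q) ^+ m * euler_moment Q ((1 - qpow Q z *: 'X) ^+ m).
Proof.
move=> Q_disk Q1 z1; have Q1' : 1 - Q != 0 by rewrite subr_eq0 eq_sym.
rewrite -[qpow Q z in RHS]mulr1 euler_moment_mix mulr_sumr.
apply: eq_bigr => l _; rewrite scale1r qEulerE// (qpow_natM p_pr v_p)// /qnum.
have -> : (1 - Q) ^+ m = (1 - Q) ^+ (m - l) * (1 - Q) ^+ l.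
  by rewrite -exprD subnK ?leq_ord.
have ? := expf_neq0 l Q1'; have ? := expf_neq0 (m - l) Q1'.
by rewrite expr_div_n; field; apply/andP.
Qed.

End QEulerPoly.

(** * Evaluation of the alternating sums over the k_j *)

(** The exponent K is additive in the k_j, so the sum factors into alternating geometric series; the
    length [a j] completes each partial product to the full one. *)
Lemma alternating_T_hat_sum (K : fieldType) (B : K) d (a : 'I_d -> nat) :
  (forall i, odd (a i)) -> (forall n, 1 + B ^+ n != 0) ->
  \sum_(k : {dffun forall j : 'I_d, 'I_(a j)})
    (- 1) ^+ (\sum_(j < d) k j)%N * B ^+ T_hat_K k
  = \prod_(j < d) ((1 + B ^+ (\prod_(i < d) a i))
                   / (1 + B ^+ (\prod_(i < d | i != j) a i))).
Proof.
move=> a_odd B_neqN1.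
transitivity (\prod_(j < d) \sum_(k < a j)
                (- (B ^+ (\prod_(i < d | i != j) a i))) ^+ k).
  rewrite bigA_distr_dffun; apply: eq_bigr => k _.
  rewrite /T_hat_K !expr_sum -big_split; apply: eq_bigr => j _ /=.
  by rewrite exprM [RHS]exprNn.
apply: eq_bigr => j _; rewrite alternating_geometric_sum//.
by rewrite -exprM [in RHS](bigD1 j)//= mulnC.
Qed.

(** * Closed form of the expression for given W, u and a *)

Section Symmetry.
Context {R : realType} {F : fieldType} (v : ultra_absval R F) (p : nat).
Hypotheses (p_pr : prime p) (v_p : v p%:R = (p%:R : R)^-1) (p_odd : odd p).
Hypothesis v_complete :
  forall G : set_system (valued v), ProperFilter G -> cauchy G -> cvg G.
Local Notation rho := (@exp_radius R p).
Variables (q x : valued v).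
Hypotheses (q_disk : v (q - 1) < rho) (q_neq1 : q != 1) (x_le1 : v x <= 1).

Let q1 : 1 - q != 0. Proof. by rewrite subr_eq0 eq_sym. Qed.

Let exprnq_disk W : v (q ^+ W - 1) < rho.
Proof. exact: (exprn_disk p_pr v_p). Qed.

Let exprnq1 W : (0 < W)%N -> 1 - q ^+ W != 0.
Proof. by move=> W0; rewrite subr_eq0 eq_sym (exprn_neq1 p_pr v_p). Qed.

Lemma qEuler_T_hat_sum W u d (a : 'I_d -> nat) m :
  (0 < W)%N -> (0 < u)%N -> (forall i, odd (a i)) ->
  (qnum (q ^+ W) 2%:R)^-1 *
  \sum_(l < m.+1)
    'C(m, l)%:R * qnum q W%:R ^+ l * qnum q u%:R ^+ (m - l)
    * qEuler_poly l (q ^+ W) (u%:R * x) * T_hat m (q ^+ u) a l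
  = (1 - q) ^- m *
    \sum_(j < m.+1)
      'C(m, j)%:R * (- qpow q ((W * u)%:R * x)) ^+ j / (1 + q ^+ (j.+1 * W))
      * \prod_(i < d) ((1 + q ^+ (j.+1 * (u * \prod_(k < d) a k)))
          / (1 + q ^+ (j.+1 * (u * \prod_(k < d | k != i) a k)))).
Proof.
move=> W0 u0 a_odd; have Q_disk := exprnq_disk W; have Q1 := exprnq1 W0.
have Q_neq1 : q ^+ W != 1 by exact: (exprn_neq1 p_pr v_p).
have Q2 : 1 + q ^+ W != 0 by exact: (add1_exprn_neq0 p_pr v_p p_odd).
have ux_le1 : v (u%:R * x) <= 1.
  by rewrite absvalM mulr_ile1 ?absval_ge0 ?absval_natr_le1.
rewrite (qnum2 p_pr v_p)//; set A := qpow q _.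
have AE : qpow (q ^+ W) (u%:R * x) = A.
  by rewrite (qpowX p_pr v_p)// mulrA -natrM.
pose c (k : {dffun forall j : 'I_d, 'I_(a j)}) := (q ^+ u) ^+ T_hat_K k.
pose sg (k : {dffun forall j : 'I_d, 'I_(a j)}) : valued v :=
  (- 1) ^+ (\sum_(j < d) k j)%N.
(* With c = q^(uK), [u]_q [K]_(q^u) = (1 - c) / (1 - q) and [W]_q / (1 - q) replaces nothing but the
   factor 1 / (1 - q^W): the powers of 1 - q^W cancel and the sum over l is the expansion of a
   single moment. *)
transitivity ((1 - q) ^- m * \sum_k sg k * c k
                * euler_moment (q ^+ W) ((1 - (c k * A) *: 'X) ^+ m)).
  under [in RHS]eq_bigr => k _ do rewrite euler_moment_mix mulr_sumr.
  rewrite exchange_big !mulr_sumr; apply: eq_bigr => l _ /=.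
  rewrite (qEuler_polyE p_pr v_p p_odd)// AE !(qnum_natr p_pr v_p)//.
  move: (euler_moment (q ^+ W) ((1 - A *: 'X) ^+ l)) => L.
  rewrite /T_hat !mulr_sumr; apply: eq_bigr => k _.
  rewrite (qnum_natr p_pr v_p)// -/(sg k).
  rewrite [(l.+1 * _)%N]mulnC exprM -/(c k) exprS !expr_div_n.
  have -> : (1 - q) ^+ m = (1 - q) ^+ (m - l) * (1 - q) ^+ l.
    by rewrite -exprD subnK ?leq_ord.
  have ? := expf_neq0 l q1; have ? := expf_neq0 (m - l) q1.
  have ? := expf_neq0 l Q1; have ? := expf_neq0 (m - l) (exprnq1 u0).
  by field; rewrite ?Q2; do !(apply/andP; split).
congr (_ * _).
under eq_bigr => k _ do rewrite euler_moment_binomial mulr_sumr.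
rewrite exchange_big; apply: eq_bigr => j _ /=.
(* The extra factor [c k] beside [c k ^+ j] raises the exponent to j + 1, so the base for K is
   q^((j+1)u). *)
transitivity ('C(m, j)%:R * (- A) ^+ j / (1 + q ^+ (j.+1 * W))
              * \sum_k sg k * (q ^+ (j.+1 * u)) ^+ T_hat_K k).
  rewrite mulr_sumr; apply: eq_bigr => k _.
  have -> : (q ^+ (j.+1 * u)) ^+ T_hat_K k = c k * c k ^+ j.
    by rewrite -exprS /c -!exprM; congr (_ ^+ _); lia.
  rewrite -mulrN exprMn -(exprM q W) [(W * _)%N]mulnC.
  by have ? := add1_exprn_neq0 p_pr v_p p_odd (j.+1 * W) q_disk; field.
congr (_ * _); rewrite alternating_T_hat_sum// => [|n]; last first.
  by rewrite -exprM; exact: (add1_exprn_neq0 p_pr v_p p_odd).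
by apply: eq_bigr => i _; rewrite -!exprM !mulnA.
Qed.

End Symmetry.

(** * Reindexing by the permutation and the symmetric form *)

Lemma prod_neq_max n (b : 'I_n.+1 -> nat) :
  (\prod_(k | k != ord_max) b k = \prod_(j < n) b (widen_ord (leqnSn n) j))%N.
Proof.
rewrite big_mkcond big_ord_recr /= eqxx muln1; apply: eq_bigr => j _.
by rewrite -val_eqE /= ltn_eqF.
Qed.

Lemma prod_neq_widen n (b : 'I_n.+1 -> nat) (j : 'I_n) :
  (\prod_(k | k != widen_ord (leqnSn n) j) b k
   = b ord_max * \prod_(k < n | k != j) b (widen_ord (leqnSn n) k))%N.
Proof.
rewrite big_mkcond big_ord_recr /= ifT; last by rewrite -val_eqE /= gtn_eqF.
rewrite mulnC; congr (_ * _)%N; rewrite [RHS]big_mkcond; apply: eq_bigr => k _.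
by rewrite -!val_eqE.
Qed.

Section Expression.
Context {R : realType} {F : fieldType} (v : ultra_absval R F) (p : nat).
Hypotheses (p_pr : prime p) (v_p : v p%:R = (p%:R : R)^-1) (p_odd : odd p).
Hypothesis v_complete :
  forall G : set_system (valued v), ProperFilter G -> cauchy G -> cvg G.

(** The right side does not involve [s]: the denominator 1 + q^((j+1)W) from the q-Euler polynomial
    is the factor at the last position, and those from the sums over the k_j are the other [n]. *)
Lemma sym_exprE (q x : valued v) n (w : 'I_n.+1 -> nat) (s : 'S_n.+1) m :
  v (q - 1) < @exp_radius R p -> q != 1 -> v x <= 1 ->
  (forall i, odd (w i)) ->
  sym_expr q x w s m
  = (1 - q) ^- m *
    \sum_(j < m.+1) 'C(m, j)%:R * (- qpow q ((\prod_i w i)%:R * x)) ^+ j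
      * (1 + q ^+ (j.+1 * \prod_i w i)) ^+ n
      / \prod_i (1 + q ^+ (j.+1 * \prod_(k | k != i) w k)).
Proof.
move=> q_disk q_neq1 x_le1 w_odd.
have w_gt0 i : (0 < w i)%N by rewrite odd_gt0.
pose b i := w (s i).
have b_neq i : (\prod_(k | k != s i) w k = \prod_(k | k != i) b k)%N.
  rewrite (reindex_inj (@perm_inj _ s)); apply: eq_bigl => k.
  by rewrite (inj_eq (@perm_inj _ s)).
have PE : (\prod_i w i = W_prod w s * w_last w s)%N.
  by rewrite (reindex_inj (@perm_inj _ s)) big_ord_recr.
have WE : (\prod_(k | k != s ord_max) w k = W_prod w s)%N.
  by rewrite b_neq prod_neq_max.
rewrite /sym_expr (qEuler_T_hat_sum p_pr v_p p_odd)//; last first.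
- by move=> i; exact: w_odd.
- exact: w_gt0.
- by rewrite /W_prod prodn_gt0// => j; exact: w_gt0.
congr (_ * _); apply: eq_bigr => j _; rewrite PE.
rewrite [in RHS](reindex_inj (@perm_inj _ s)) big_ord_recr /= WE.
under [in RHS]eq_bigr => i _ do rewrite b_neq prod_neq_widen.
rewrite prodf_div prodr_const card_ord [(w_last w s * _)%N]mulnC.
by rewrite invfM !mulrA [RHS]mulrAC; congr (_ / _); exact: mulrAC.
Qed.

End Expression.

(** * Independence of the permutation *)

Theorem theorem2p3 (R : realType) (p : nat) (K : fieldType)
  (v : ultra_absval R K) (p_prime : prime p) (p_odd : odd p) (K_Cp : is_Cp v p)
  (q : valued v) (q_neq1 : q <> 1)
  (q_near1 : v (1 - q) < (p%:R : R) `^ (- (p.-1%:R)^-1))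
  (x : valued v) (x_Zp : padicZ x)
  (n : nat) (w : 'I_n.+1 -> nat)
  (w_gt0 : forall i : 'I_n.+1, (0 < w i)%N)
  (w_odd : forall i : 'I_n.+1, (w i = 1 %[mod 2])%N)
  (m : nat) (s t : 'S_n.+1) :
  sym_expr q x w s m = sym_expr q x w t m.
Proof.
have v_p := Cp_absvalp K_Cp; have v_complete := Cp_complete K_Cp.
have w_odd' i : odd (w i) by have := w_odd i; rewrite !modn2; case: odd.
have q_disk : v (q - 1) < @exp_radius R p by rewrite -opprB absvalN.
rewrite !(sym_exprE p_prime v_p p_odd v_complete _ _ q_disk)//;
  by [exact/eqP | exact: padicZ_absval_le1].
Qed.
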